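(* Let $0\leq\epsilon_1\leq 1$ and $0\leq\epsilon_2\leq 2$ be real numbers. Then the capacity $\widetilde{C}(\epsilon_1,\epsilon_2)$ of asymmetric two-neighbor $k$-constrained codes with minimum inversion distance $d$, where $k=\lceil n^{\epsilon_1}\rceil$ and $d=\lceil n^{\epsilon_2}\rceil$, is $$\widetilde{C}(\epsilon_1,\epsilon_2)=\begin{cases}1, & 0\leq\epsilon_2\leq 1,\\ 2-\epsilon_2, & 1<\epsilon_2\leq 2.\end{cases}$$
   Context: $S_n$ is the set of all permutations of $\{1,\ldots,n\}$, written $\sigma=[\sigma(1),\ldots,\sigma(n)]$. For positive integers $n,k$, a permutation $\sigma\in S_n$ satisfies the asymmetric two-neighbor $k$-constraint if for all $i$ with $2\leq i\leq n-1$, either $\sigma(i-1)-\sigma(i)\leq k$ or $\sigma(i+1)-\sigma(i)\leq k$ (inclusive or; signed differences). $B_{n,k}$ is the set of all permutations in $S_n$ satisfying this constraint. An adjacent transposition on $\sigma$ exchanges the entries $\sigma(i),\sigma(i+1)$ in two adjacent positions. The Kendall's $\tau$ distance $d_K(\sigma,\pi)$ is the minimum number of adjacent transpositions required to obtain $\pi$ from $\sigma$. The inversion distance is $d_I(\sigma,\pi)=d_K(\sigma^{-1},\pi^{-1})$. A code (set of permutations) has minimum inversion distance $d$ if any two distinct elements are at inversion distance at least $d$ (a one-element set qualifies). Let $\widetilde{E}(n,k,d)$ be the maximum size of a code contained in $B_{n,k}$ with minimum inversion distance $d$. For $k=\lceil n^{\epsilon_1}\rceil$ and $d=\lceil n^{\epsilon_2}\rceil$,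 define $\widetilde{C}(\epsilon_1,\epsilon_2)=\lim_{n\to\infty}\frac{\log\widetilde{E}(n,k,d)}{\log n!}$, with logarithms to base 2 (the claim includes that this limit exists). *)

(* Defs.v *)
From HB Require Import structures.
From mathcomp Require Import all_boot all_order all_algebra all_fingroup.
From mathcomp Require Import all_classical all_reals all_analysis.

Set Implicit Arguments.
Unset Strict Implicit.
Unset Printing Implicit Defensive.

Import Order.TTheory GRing.Theory Num.Theory.
Import numFieldNormedType.Exports.

Local Open Scope ring_scope.

(* MathComp world.  Positions and values are numbered from 0 rather than
   from 1; the constraint and the distances only involve differences of values
   and adjacency of positions, so they are not affected by the shift. *)

(* [h], [i], [j] are consecutive positions, so [i] ranges over the interior
   positions; the differences are taken in [int]. *)
Definition two_neighbor (n k : nat) (s : 'S_n) : bool :=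
  [forall h : 'I_n, forall i : 'I_n, forall j : 'I_n,
    (i == h.+1 :> nat) && (j == i.+1 :> nat) ==>
    ((s h : nat)%:Z - (s i : nat)%:Z <= k%:Z)
    || ((s j : nat)%:Z - (s i : nat)%:Z <= k%:Z)].

Definition B (n k : nat) : {set 'S_n} := [set s | two_neighbor k s].

(* Since [(t * s) x = s (t x)] in MathComp, multiplying by [tperm i j] on the
   left exchanges the entries of [s] at the positions [i] and [j]. *)
Definition adj_transp (n : nat) (s t : 'S_n) : bool :=
  [exists i : 'I_n, exists j : 'I_n,
    (j == i.+1 :> nat) && (t == (tperm i j * s)%g)].

Definition reachable_in (n : nat) (s t : 'S_n) (m : nat) : bool :=
  [exists w : m.-tuple 'S_n, path (@adj_transp n) s w && (last s w == t)].

Lemma connect_tperm (n : nat) (m : nat) (x y : 'I_n) (s : 'S_n) :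
  (y = x + m :> nat)%N -> connect (@adj_transp n) s (tperm x y * s)%g.
Proof.
elim: m y s => [|m IHm] y s yE.
  have -> : y = x by apply: val_inj; rewrite /= yE addn0.
  by rewrite tperm1 mul1g connect0.
case: m IHm yE => [|m] IHm yE.
  apply: connect1; apply/existsP; exists x; apply/existsP; exists y.
  by rewrite yE addn1 !eqxx.
have zn : (x + m.+1 < n)%N.
  by apply: (leq_ltn_trans _ (ltn_ord y)); rewrite yE leq_add2l.
pose z := Ordinal zn.
have ztx : tperm x y = (tperm z y * (tperm x z * tperm z y))%g.
  have := tpermJ x z (tperm z y).
  rewrite tpermL tpermD; first by rewrite conjgE tpermV => <-.
    by rewrite -val_eqE /= -[X in _ != X]addn0 eqn_add2l.
  by rewrite -val_eqE /= yE -[X in _ != X]addn0 eqn_add2l.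
have step (r : 'S_n) : connect (@adj_transp n) r (tperm z y * r)%g.
  apply: connect1; apply/existsP; exists z; apply/existsP; exists y.
  by rewrite eqxx yE /= addnS eqxx.
rewrite ztx -!mulgA.
exact: connect_trans (step s) (connect_trans (IHm z _ _) (step _)).
Qed.

Lemma connect_adj_transp (n : nat) (s t : 'S_n) :
  connect (@adj_transp n) s t.
Proof.
have [ts tsE _] := prod_tpermP (t * s^-1)%g.
have -> : t = ((\prod_(u <- ts) tperm u.1 u.2) * s)%g.
  by rewrite -tsE mulgKV.
elim: ts {tsE} => [|[x y] ts IHts]; first by rewrite big_nil mul1g connect0.
rewrite big_cons -mulgA; apply: connect_trans IHts _ => /=.
have [xy|/ltnW yx] := leqP x y.
  by apply: (@connect_tperm _ (y - x)); rewrite subnKC.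
by rewrite tpermC; apply: (@connect_tperm _ (x - y)); rewrite subnKC.
Qed.

Lemma ex_reachable_in (n : nat) (s t : 'S_n) : exists m, reachable_in s t m.
Proof.
have /connectP[w sw tE] := connect_adj_transp s t.
by exists (size w); apply/existsP; exists (in_tuple w); rewrite sw tE eqxx.
Qed.

Definition kendall_tau (n : nat) (s t : 'S_n) : nat :=
  ex_minn (ex_reachable_in s t).

Definition inversion_dist (n : nat) (s t : 'S_n) : nat :=
  kendall_tau s^-1%g t^-1%g.

Definition min_inversion_dist (n d : nat) (C : {set 'S_n}) : bool :=
  [forall s in C, forall t in C, (s != t) ==> (d <= inversion_dist s t)%N].

Definition E (n k d : nat) : nat :=
  (\max_(C : {set 'S_n} | (C \subset B n k) && min_inversion_dist d C) #|C|)%N.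

Section Capacity.
Variable R : realType.

Definition log2 (x : R) : R := ln x / ln 2%:R.

(* [absz] only converts the ceiling, nonnegative here, from [int] to [nat]. *)
Definition ceil_pow (n : nat) (e : R) : nat := `|Num.ceil (n%:R `^ e)|%N.

(* The terms n = 0, 1, where the denominator is 0, have no bearing on the
   limit. *)
Definition rate (e1 e2 : R) (n : nat) : R :=
  log2 (E n (ceil_pow n e1) (ceil_pow n e2))%:R / log2 (n`!)%:R.

(* Meaningful only together with the convergence of [rate e1 e2]. *)
Definition capacity (e1 e2 : R) : R := limn (rate e1 e2).

End Capacity.

(* Main.v *)
Require Import Defs.
From mathcomp Require Import all_boot all_order all_algebra all_fingroup.
From mathcomp Require Import all_classical all_reals all_analysis.
From mathcomp Require Import zify ring lra.
Import Order.TTheory GRing.Theory Num.Theory.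
Import numFieldNormedType.Exports.
Local Open Scope ring_scope.

(* The inversion distance of s and t is the number of inversions of t^-1 s, so
   that balls can be counted by Lehmer codes: a ball of radius r has at most
   C(n + r, n) elements.

   Upper bound: if the values are cut into intervals of length b, permutations
   which agree up to the interval of each value are at distance at most
   n (b - 1). With b = ceil(n^(e2 - 1)) this is less than d, hence a code
   injects into the functions from positions to intervals.

   Lower bound: by Gilbert-Varshamov it suffices to see that ln #|B n k| is
   equivalent to n ln n, already for k = 1. Take concatenations of L increasing
   runs, the j-th one starting with 2j, 2j + 1: the n - 2L other values are
   distributed freely among the runs, and L = ceil(n / ln n) makes L^(n - 2L)
   large enough. *)

(** * Inversions and Lehmer codes *)

Section Inversions.
Local Open Scope nat_scope.
Context {n : nat}.
Implicit Types (p q g u v s t : 'S_n) (i j x y : 'I_n).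

Definition inversions p : {set 'I_n * 'I_n} :=
  [set xy : 'I_n * 'I_n | (xy.1 < xy.2) && (p xy.2 < p xy.1)].

Definition ninv p := #|inversions p|.

(** No position lies between [i] and [j], so exchanging them reverses the order of that pair
    only. *)
Lemma tperm_succ_lt i j x y : j = i.+1 :> nat -> x < y ->
  (x, y) != (i, j) -> tperm i j x < tperm i j y.
Proof.
move=> ij; rewrite xpair_eqE -!val_eqE /=.
by case: tpermP => [->|->|/eqP + /eqP +]; case: tpermP => [->|->|/eqP + /eqP +];
  rewrite -?val_eqE /=; lia.
Qed.

(** Applying [tperm i j] to both coordinates injects the first set into the second. *)
Lemma card_inversions_tperm i j p : j = i.+1 :> nat ->
  #|inversions (tperm i j * p)%g :\ (i, j)| <= #|inversions p :\ (i, j)|.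
Proof.
move=> ij; pose f (xy : 'I_n * 'I_n) := (tperm i j xy.1, tperm i j xy.2).
have f_inj : injective f.
  by move=> [x y] [x' y'] [/perm_inj-> /perm_inj->].
rewrite -(card_imset _ f_inj); apply/subset_leq_card/fintype.subsetP.
move=> _ /imsetP[[x y] + ->]; rewrite !inE /= !permM => /andP[xyij /andP[xy ->]].
rewrite andbT (tperm_succ_lt _ _ _ _ ij xy xyij) andbT.
apply/eqP => -[/(canRL (tpermK i j)) + /(canRL (tpermK i j))].
by rewrite tpermL tpermR => xj yi; move: xy; rewrite xj yi ij; lia.
Qed.

Lemma ninv_tperm_leq i j p : j = i.+1 :> nat ->
  ninv (tperm i j * p)%g <= (ninv p).+1.
Proof.
move=> ij; have := card_inversions_tperm _ _ p ij.
rewrite /ninv (cardsD1 (i, j) (inversions p)).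
rewrite (cardsD1 (i, j) (inversions (tperm i j * p)%g)) => le_D.
rewrite -add1n leq_add ?leq_b1//; exact: leq_trans le_D (leq_addl _ _).
Qed.

Lemma ninv_tperm_lt i j p : j = i.+1 :> nat -> p j < p i ->
  ninv (tperm i j * p)%g < ninv p.
Proof.
move=> ij pji; have := card_inversions_tperm _ _ p ij.
rewrite /ninv (cardsD1 (i, j) (inversions p)).
rewrite (cardsD1 (i, j) (inversions (tperm i j * p)%g)) !inE /= !permM.
by rewrite tpermL tpermR [p i < p j]ltnNge (ltnW pji) andbF pji ij ltnSn.
Qed.

(** Both sides of [x <= p x] have the same sum over [x], so each of these inequalities is an
    equality. *)
Lemma perm_ge_id p : (forall x, x <= p x) -> p = 1%g.
Proof.
move=> ge_p; apply/permP => x; rewrite perm1; apply/val_inj/eqP.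
have /leqif_sum[_] : forall y, xpredT y -> val y <= p y ?= iff (val y == p y).
  by move=> y _; apply: leqif_eq; apply: ge_p.
have <- : \sum_(y : 'I_n) (y : nat) = \sum_y (p y : nat) by rewrite (reindex_perm p).
by rewrite eqxx => /esym/forall_inP/(_ x isT); rewrite eq_sym.
Qed.

(** Otherwise [p] increases from each position to the next, and induction gives [x <= p x]. *)
Lemma adjacent_descent p : p != 1%g ->
  exists ij : 'I_n * 'I_n, ij.2 = ij.1.+1 :> nat /\ p ij.2 < p ij.1.
Proof.
move=> p1; apply/not_existsP => asc; case/eqP: p1; apply: perm_ge_id => -[m].
elim: m => [//|m IHm] lt_m1; have lt_m : m < n by lia.
have := asc (Ordinal lt_m, Ordinal lt_m1); have := IHm lt_m => /=.
set i := Ordinal lt_m; set j := Ordinal lt_m1 => ip /not_andP[//|].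
have : p i != p j by rewrite (inj_eq perm_inj) -val_eqE /=; lia.
by rewrite -val_eqE /=; lia.
Qed.

(** Bubble sort: exchanging an adjacent descent of [g] removes an inversion; the path to the result
    is then extended by the same exchange, which undoes it. *)
Lemma reachable_ninv g u : exists2 m, m <= ninv g & reachable_in u (g * u)%g m.
Proof.
have [k] := ubnP (ninv g); elim: k g => [//|k IHk] g; rewrite ltnS => gk.
have [->|g1] := eqVneq g 1%g.
  exists 0 => //; apply/existsP; exists [tuple].
  by rewrite mul1g /= eqxx.
have [[i j] /= [ij gji]] := adjacent_descent _ g1.
have lt_inv := ninv_tperm_lt _ _ _ ij gji.
have [m le_m /existsP[w /andP[uw /eqP wE]]] := IHk _ (leq_trans lt_inv gk).
exists m.+1; first exact: leq_ltn_trans lt_inv.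
apply/existsP; exists [tuple of rcons w (g * u)%g].
rewrite /= rcons_path last_rcons eqxx andbT uw wE /=.
apply/existsP; exists i; apply/existsP; exists j.
by rewrite ij eqxx /= !mulgA tperm2 mul1g.
Qed.

(** Bubble sort gives one inequality. For the other, each exchange along a path from [u] adds at
    most one inversion to the quotient by [u]. *)
Lemma kendall_tau_ninv u v : kendall_tau u v = ninv (v * u^-1)%g.
Proof.
rewrite /kendall_tau; case: ex_minnP => m /existsP[w /andP[uw /eqP wv]] min_m.
apply/eqP; rewrite eqn_leq; apply/andP; split.
  have [k le_k] := reachable_ninv (v * u^-1)%g u.
  by rewrite mulgKV => /min_m/leq_trans; apply.
rewrite -wv -[leqRHS](size_tuple w) {wv min_m}; move: uw.
elim/last_ind: (tval w) => {m w} [|w t IHw].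
  rewrite mulgV /= leqn0 cards_eq0 => _; apply/eqP/setP => -[x y].
  by rewrite !inE /= !perm1; lia.
rewrite rcons_path last_rcons size_rcons => /andP[/IHw le_w].
move=> /existsP[i /existsP[j /andP[/eqP ij /eqP->]]].
by rewrite -mulgA (leq_trans (ninv_tperm_leq _ _ _ ij)).
Qed.

Lemma inversion_dist_ninv s t : inversion_dist s t = ninv (t^-1 * s)%g.
Proof. by rewrite /inversion_dist kendall_tau_ninv invgK. Qed.

Definition lehmer p x : nat := #|[set y : 'I_n | (x < y) && (p y < p x)]|.

Lemma sum_lehmer p : \sum_x lehmer p x = ninv p.
Proof.
rewrite /ninv -sum1_card (eq_bigl (fun xy : 'I_n * 'I_n =>
    true && ((xy.1 < xy.2) && (p xy.2 < p xy.1))));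
  last by move=> xy; rewrite inE.
rewrite -(pair_big_dep xpredT (fun x y : 'I_n => (x < y) && (p y < p x))
  (fun _ _ => 1)) /=.
apply: eq_bigr => x _; rewrite /lehmer -sum1_card.
by apply: eq_bigl => y; rewrite inE.
Qed.

(** In this form the code at [x] is the rank of [p x] among the values not taken before [x]. *)
Lemma lehmer_values p x :
  lehmer p x = #|[set v : 'I_n | (x <= p^-1%g v) && (v < p x)]|.
Proof.
rewrite /lehmer -(card_imset _ (@perm_inj _ p)); apply: eq_card => v.
rewrite -[v](permKV p) mem_imset; last exact: perm_inj.
rewrite !inE permK; set y := p^-1%g v.
rewrite [x <= y]leq_eqVlt.
by have [/val_inj<-|] := eqVneq (x : nat) y; rewrite ?ltnn ?andbF.
Qed.

(** By strong induction on the position: permutations that agree before [x] leave the same values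
    available, and the code picks one of them by its rank. *)
Lemma lehmer_inj p q : lehmer p =1 lehmer q -> p = q.
Proof.
move=> pq; apply/permP => -[m]; have [k] := ubnP m; elim: k m => // k IHk m.
rewrite ltnS => mk lt_m; set x := Ordinal lt_m.
have eq_lt y : y < x -> p y = q y.
  by case: y => y lt_y /= yx; apply: IHk; apply: leq_trans mk.
have leq_inv (r s : 'S_n) (v : 'I_n) : (forall y, y < x -> r y = s y) ->
    r^-1%g v < x -> s^-1%g v < x.
  move=> rs lt_v; suff -> : s^-1%g v = r^-1%g v by [].
  by apply: (@perm_inj _ s); rewrite permKV -(rs _ lt_v) permKV.
have {leq_inv}eq_lt (v : 'I_n) : (x <= p^-1%g v) = (x <= q^-1%g v).
  rewrite leqNgt [RHS]leqNgt; congr negb; apply/idP/idP; apply: leq_inv => // y yx.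
  by rewrite eq_lt.
suff leqpq : forall r s : 'S_n, lehmer r x = lehmer s x ->
    (forall v : 'I_n, (x <= r^-1%g v) = (x <= s^-1%g v)) -> s x <= r x.
  by apply/val_inj/eqP; rewrite eqn_leq !leqpq.
(* If [r x < s x], all values counted for [r] are counted for [s], and so is [r x] itself, which is
   not counted for [r]. *)
move=> r s rs eq_rs; rewrite leqNgt; apply/negP => lt_rs.
suff : lehmer r x < lehmer s x by rewrite rs ltnn.
rewrite !lehmer_values; apply: proper_card; apply/properP; split.
  by apply/fintype.subsetP => v; rewrite !inE eq_rs => /andP[-> /ltn_trans->].
by exists (r x); rewrite !inE -?eq_rs ?permK ?leqnn ?ltnn ?lt_rs.
Qed.

(** Lehmer codes inject these permutations into the [n]-tuples of naturals of sum at most [r]. Each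
    entry is bounded by the sum, so [inord] truncates nothing. *)
Lemma card_ninv_leq r : #|[set p | ninv p <= r]| <= 'C(n + r, n).
Proof.
rewrite -card_partial_ord_partitions.
pose code p : n.-tuple 'I_r.+1 := [tuple inord (lehmer p x) | x < n].
have lehmer_leq p x : ninv p <= r -> lehmer p x < r.+1.
  by rewrite ltnS -sum_lehmer; apply: leq_trans; rewrite (bigD1 x) //= leq_addr.
rewrite -(@card_in_imset _ _ code).
  apply/subset_leq_card/fintype.subsetP => _ /imsetP[p + ->].
  rewrite !inE => p_r; rewrite big_tuple -sum_lehmer in p_r *.
  by under eq_bigr do rewrite tnth_mktuple inordK ?lehmer_leq -?sum_lehmer//.
move=> p q; rewrite !inE => pr qr pq; apply: lehmer_inj => x.
have /(congr1 (fun c => nat_of_ord (tnth c x))) := pq.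
by rewrite !tnth_mktuple !inordK ?lehmer_leq.
Qed.

End Inversions.

(** * Bounds on codes *)

Section CodeBounds.
Local Open Scope nat_scope.
Context {n : nat}.
Implicit Types (p s t : 'S_n) (x y : 'I_n).

(** An inversion [(x, y)] of [p] yields the inversion [(p y, p x)] of its inverse; the converse
    inequality is this one for [p^-1]. *)
Lemma ninvV p : ninv (p^-1)%g = ninv p.
Proof.
wlog suff le_inv : p / ninv p <= ninv (p^-1)%g.
  by apply/eqP; rewrite eqn_leq le_inv -{2}[p]invgK le_inv.
pose f (xy : 'I_n * 'I_n) := (p xy.2, p xy.1).
have f_inj : injective f.
  by move=> [x y] [x' y'] [/perm_inj-> /perm_inj->].
rewrite /ninv -(card_imset _ f_inj); apply/subset_leq_card/fintype.subsetP.
by move=> _ /imsetP[[x y] + ->]; rewrite !inE /= !permK andbC.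
Qed.

Lemma inversion_distC s t : inversion_dist s t = inversion_dist t s.
Proof. by rewrite !inversion_dist_ninv -ninvV invMg invgK. Qed.

(** If [x < y] and [p y < p x], then [y] is in the block of [x], hence among the [b - 1] integers
    after [x]: every Lehmer entry is at most [b - 1]. *)
Lemma ninv_block p b : 0 < b -> (forall x, p x %/ b = x %/ b) ->
  ninv p <= n * b.-1.
Proof.
move=> b0 pb; rewrite -sum_lehmer -[n in n * _]card_ord -sum_nat_const.
apply: leq_sum => x _; rewrite /lehmer cardE -(size_map val).
rewrite -(size_iota x.+1 b.-1); apply: uniq_leq_size.
  by rewrite map_inj_uniq ?enum_uniq//; apply: val_inj.
move=> _ /mapP[y + ->]; rewrite mem_enum inE mem_iota => /andP[xy pyx].
have := leq_div2r b (ltnW pyx); rewrite !pb => le_yx.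
have eq_xy : x %/ b = y %/ b by apply/eqP; rewrite eqn_leq le_yx leq_div2r// ltnW.
rewrite xy (divn_eq x b) eq_xy [ltnLHS](divn_eq y b) /=.
by have := ltn_pmod y b0; lia.
Qed.

Lemma E_le_block k d b : 0 < b -> n * b.-1 < d ->
  E n k d <= (n %/ b).+1 ^ n.
Proof.
move=> b0 nbd; apply/bigmax_leqP => C /andP[_ /forall_inP minC].
pose blk s : {ffun 'I_n -> 'I_(n %/ b).+1} := [ffun x => inord (s x %/ b)].
rewrite -[(_ %/ _).+1]card_ord -[X in _ ^ X](card_ord n) -card_ffun.
rewrite -(@card_in_imset _ _ blk) ?max_card// => s t sC tC eq_st.
apply/eqP/idPn => st; move: nbd; apply/negP; rewrite -leqNgt.
have /forall_inP/(_ t tC)/implyP/(_ st) := minC s sC.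
move=> /leq_trans; apply; rewrite inversion_dist_ninv; apply: ninv_block => // x.
(* At the position [t^-1 x], [t] takes the value [x], so the value of [s] there lies in the block of
   [x]. *)
have /(congr1 (fun f : {ffun _ -> 'I_(n %/ b).+1} => val (f (t^-1%g x)))) := eq_st.
rewrite !ffunE /= !inordK ?ltnS ?leq_div2r// 1?ltnW//.
by rewrite permM permKV.
Qed.

Lemma E_le_fact k d : E n k d <= n`!.
Proof.
by apply/bigmax_leqP => C _; rewrite -card_Sn -cardsT subset_leq_card ?subsetT.
Qed.

(** The balls of radius [d - 1] around a code maximal for inclusion cover [B n k]. The ball around
    [c] consists of the products [c * p] with [ninv p <= d - 1]. *)
Lemma gilbert_varshamov k d : 0 < d ->
  #|B n k| <= E n k d * 'C(n + d.-1, n).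
Proof.
move=> d0; pose P (C : {set 'S_n}) := (C \subset B n k) && min_inversion_dist d C.
have P0 : P finset.set0.
  by rewrite /P finset.sub0set; apply/forall_inP => s; rewrite inE.
have [C /maxsetP[PC maxC] _] := maxset_exists P0.
have leCE : #|C| <= E n k d by apply: (@leq_bigmax_cond _ P).
apply: leq_trans (leq_mul leCE (card_ninv_leq d.-1)).
rewrite -cardsX; set X := finset.setX _ _.
apply: leq_trans (leq_imset_card (fun cp : 'S_n * 'S_n => (cp.1 * cp.2)%g) X).
apply/subset_leq_card/fintype.subsetP => s sB.
have inX c : c \in C -> inversion_dist c s < d ->
    s \in [set (cp.1 * cp.2)%g | cp in X].
  move=> cC cs; apply/imsetP; exists (c, c^-1 * s)%g; last by rewrite /= mulKVg.
  rewrite !inE cC /=; move: cs; rewrite inversion_distC inversion_dist_ninv.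
  by lia.
apply/idPn => sX; have sC : s \notin C.
  apply/negP => /inX sC; move: sX; rewrite sC// inversion_dist_ninv mulVg.
  suff /eqP-> : ninv (1%g : 'S_n) == 0 by [].
  by rewrite -leqn0 -[leqRHS](muln0 n) (@ninv_block 1%g 1)// => x; rewrite perm1.
suff /maxC : P (s |: C)%SET.
  by rewrite finset.subsetUr => /(_ isT) CE; move: sC; rewrite -CE finset.setU11.
have far c : c \in C -> d <= inversion_dist c s.
  by move=> cC; rewrite leqNgt; apply: contra sX; apply: inX.
case/andP: PC => CB /forall_inP minC.
rewrite /P finset.subUset finset.sub1set sB CB /=; apply/forall_inP => u.
case/finset.setU1P => [->|uC]; apply/forall_inP => v;
  case/finset.setU1P => [->|vC]; apply/implyP.
- by rewrite eqxx.
- by move=> _; rewrite inversion_distC far.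
- by move=> _; apply: far.
- by apply/implyP; have /forall_inP := minC u uC; apply.
Qed.

End CodeBounds.

(** * Many constrained permutations *)

Section RunPermutations.
Local Open Scope nat_scope.
Context {n : nat}.
Implicit Types (seg : 'I_n -> nat) (u v w : 'I_n).

(** Encodes the lexicographic order on the pairs [(seg v, v)], as [v < n]. *)
Definition run_key seg v := seg v * n + v.

Lemma run_key_inj seg : injective (run_key seg).
Proof.
move=> u v; rewrite /run_key => eq_key; apply/val_inj => /=.
rewrite -(modn_small (ltn_ord u)) -(modn_small (ltn_ord v)).
by rewrite -[u %% n](modnMDl (seg u)) eq_key modnMDl.
Qed.

Lemma run_rank_subproof seg v : #|[set w | run_key seg w < run_key seg v]| < n.
Proof.
rewrite -[ltnRHS]card_ord -cardsT; apply: proper_card; apply/properP.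
by split; [exact: finset.subsetT | exists v; rewrite !inE ?ltnn].
Qed.

(** The position of the value [v] once the values are sorted by key; the permutation itself is
    therefore the inverse of this map. *)
Definition run_rank seg v : 'I_n := Ordinal (run_rank_subproof seg v).

Lemma ltn_run_rank seg u v :
  (run_rank seg u < run_rank seg v) = (run_key seg u < run_key seg v).
Proof.
have lt_rank w w' : run_key seg w < run_key seg w' ->
    run_rank seg w < run_rank seg w'.
  move=> ww'; apply: proper_card; apply/properP; split.
    by apply/fintype.subsetP => x; rewrite !inE => /ltn_trans; apply.
  by exists w; rewrite !inE ?ltnn.
apply/idP/idP; last exact: lt_rank.
have [//|lt_vu|/run_key_inj->] := ltngtP (run_key seg u) (run_key seg v);
  last by rewrite ltnn.
by rewrite ltnNge ltnW ?lt_rank.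
Qed.

Lemma run_rank_inj seg : injective (run_rank seg).
Proof.
move=> u v uv; apply: (@run_key_inj seg); apply/eqP.
by rewrite eqn_leq leqNgt -ltn_run_rank uv ltnn /= leqNgt -ltn_run_rank uv ltnn.
Qed.

(* [seg v] is the index of the increasing run that contains the value [v]; the
   runs are concatenated by increasing index. *)
Definition run_perm seg : 'S_n := ((perm (@run_rank_inj seg))^-1)%g.

(* Run [j] starts with 2j, 2j+1 for each j < L: its first element, the only one
   that can be a valley, is then followed by its successor. *)
Definition marked L seg :=
  (forall v, seg v < L) /\ (forall v, v < L.*2 -> seg v = v./2).

Lemma run_perm_B L k seg : L.*2 <= n -> 0 < k -> marked L seg ->
  run_perm seg \in B n k.
Proof.
move=> Ln k0 [segL seg2]; rewrite inE; apply/forallP => h; apply/forallP => i.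
apply/forallP => j; apply/implyP => /andP[/eqP ih /eqP ji].
have rankK x : run_rank seg (run_perm seg x) = x.
  by rewrite -[run_rank seg _](permE (@run_rank_inj seg)) /run_perm permKV.
move: (rankK h) (rankK i) (rankK j).
move: (run_perm seg h) (run_perm seg i) (run_perm seg j) => a b c ah bi cj.
have lt_ab : run_key seg a < run_key seg b by rewrite -ltn_run_rank ah bi ih.
have lt_bc : run_key seg b < run_key seg c by rewrite -ltn_run_rank bi cj ji.
(* Adjacent positions: no key lies strictly between those of [a] and [b], nor between those of [b]
   and [c]. *)
have gap_ab u : run_key seg a < run_key seg u -> run_key seg b <= run_key seg u.
  by rewrite -ltn_run_rank ah [run_key _ b <= _]leqNgt -ltn_run_rank bi ih; lia.
have gap_bc u : run_key seg b < run_key seg u -> run_key seg c <= run_key seg u.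
  by rewrite -ltn_run_rank bi [run_key _ c <= _]leqNgt -ltn_run_rank cj ji; lia.
(* Either [b] continues the run of [a], so that [a < b], or it starts a new run and must be shown to
   be followed by [b + 1]. *)
have [seg_ab|seg_ab] := leqP (seg b) (seg a).
  apply/orP; left; suff : a < b by lia.
  by move: lt_ab; rewrite /run_key; nia.
have bL := segL b.
have lt_u : (seg b).*2 < n by lia.
have lt_u' : (seg b).*2.+1 < n by lia.
have seg_u : seg (Ordinal lt_u) = seg b by rewrite seg2 /=; lia.
have seg_u' : seg (Ordinal lt_u') = seg b by rewrite seg2 /=; lia.
(* The value [2 * seg b] lies in the run of [b], hence after [a], so [b <= 2 * seg b < 2L]. Thus [b]
   is itself a marked value, which forces equality. *)
have /gap_ab : run_key seg a < run_key seg (Ordinal lt_u).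
  by rewrite /run_key seg_u /=; have := ltn_ord a; nia.
rewrite /run_key seg_u leq_add2l /= => le_b.
have b2 : seg b = b./2 by rewrite seg2; lia.
have {le_b} bE : b = (seg b).*2 :> nat by lia.
have cE : c = Ordinal lt_u'.
  apply/(@run_key_inj seg)/eqP; rewrite eqn_leq gap_bc /=.
    by move: lt_bc; rewrite {3}/run_key seg_u' /= {1}/run_key bE; lia.
  by rewrite /run_key seg_u' /= bE; lia.
by apply/orP; right; rewrite cE /=; lia.
Qed.

(** An unmarked [v] comes after the head [2 * seg1 v] of its run. This head has the same index under
    [seg2], so [v] cannot have a smaller one there. *)
Lemma run_perm_inj_leq L seg1 seg2 : L.*2 <= n -> marked L seg1 -> marked L seg2 ->
  run_perm seg1 = run_perm seg2 -> forall v, seg1 v <= seg2 v.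
Proof.
move=> Ln [seg1L seg1E] [seg2L seg2E] /invg_inj eq12 v.
have [v2|v2] := ltnP v L.*2; first by rewrite seg1E ?seg2E.
rewrite leqNgt; apply/negP => lt_seg; have vL := seg1L v.
have lt_u : (seg1 v).*2 < n by lia.
have : run_rank seg1 (Ordinal lt_u) < run_rank seg1 v.
  by rewrite ltn_run_rank /run_key (seg1E (Ordinal lt_u)) /= ?doubleK; lia.
have eq_rank u : run_rank seg1 u = run_rank seg2 u.
  by rewrite -[LHS](permE (@run_rank_inj seg1)) eq12 permE.
rewrite !eq_rank ltn_run_rank /run_key (seg2E (Ordinal lt_u)) /= ?doubleK;
  last by lia.
by have := ltn_ord v; nia.
Qed.

Lemma card_B_ge L k : L.*2 <= n -> 0 < k -> L ^ (n - L.*2) <= #|B n k|.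
Proof.
move=> Ln k0; pose seg (f : {ffun 'I_(n - L.*2) -> 'I_L}) (v : 'I_n) : nat :=
  (* For [v < 2L] the truncated difference is 0, which [insub] may accept: hence the inner test. The
     value [None] occurs only when [n = 2L]. *)
  if insub (v - L.*2) is Some i then (if v < L.*2 then v./2 else f i) else v./2.
have marked_seg f : marked L (seg f).
  rewrite /seg; split => v; last by case: insub => [i|//] ->.
  by case: insubP => [i _ _|]; [case: ifP => v2; rewrite ?ltn_ord
    | have := ltn_ord v]; lia.
rewrite -[X in _ ^ X]card_ord -[X in X ^ _]card_ord -card_ffun.
rewrite -(@card_imset _ _ (fun f => run_perm (seg f))); last first.
  move=> f g fg; apply/ffunP => i; apply/val_inj => /=.
  have lt_v : L.*2 + i < n by have := ltn_ord i; lia.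
  have segE h : seg h (Ordinal lt_v) = h i.
    rewrite /seg /= addKn; case: insubP => [j _ ji|]; last by rewrite ltn_ord.
    by rewrite ltnNge leq_addr; congr (val (h _)); apply: val_inj.
  have seg_le f1 g1 : run_perm (seg f1) = run_perm (seg g1) -> f1 i <= g1 i.
    by move=> fg1; rewrite -!segE; apply: (@run_perm_inj_leq L).
  by apply/eqP; rewrite eqn_leq !seg_le.
apply/subset_leq_card/fintype.subsetP => _ /imsetP[f _ ->].
exact: (@run_perm_B L).
Qed.

End RunPermutations.

(** * Asymptotics *)

Section Logarithms.
Context {R : realType}.
Implicit Types (n m k d : nat) (e x : R).

Lemma ler_ln_nat m n : (0 < m)%N -> (m <= n)%N -> ln m%:R <= ln n%:R :> R.
Proof. by move=> m0 mn; rewrite ler_ln ?posrE ?ltr0n ?ler_nat// (leq_trans m0). Qed.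

Lemma ln_natX m n : (0 < m)%N -> ln (m ^ n)%:R = n%:R * ln m%:R :> R.
Proof. by move=> m0; rewrite natrX lnXn ?ltr0n// mulr_natl. Qed.

Lemma ln_natM m n : (0 < m)%N -> (0 < n)%N ->
  ln (m * n)%:R = ln m%:R + ln n%:R :> R.
Proof. by move=> m0 n0; rewrite natrM lnM ?posrE ?ltr0n. Qed.

Lemma ln2_le1 : ln 2 <= 1 :> R.
Proof. by rewrite -[2]/(1 + 1) le_ln1Dx//; lra. Qed.

Lemma ffact_leq_expn n m : (n ^_ m <= n ^ m)%N.
Proof.
elim: m => // m IHm.
by rewrite ffactnSr expnSr leq_mul// leq_subr.
Qed.

Lemma ln_fact_le n : (0 < n)%N -> ln n`!%:R <= n%:R * ln n%:R :> R.
Proof.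
move=> n0; rewrite -ln_natX// ler_ln_nat ?fact_gt0//.
by rewrite -ffactnn ffact_leq_expn.
Qed.

(** The induction step amounts to [m * ln (1 + 1/m) <= 1]. *)
Lemma ln_fact_ge n : n%:R * ln n%:R - n%:R <= ln n`!%:R :> R.
Proof.
elim: n => [|[|n] IHn]; first by rewrite mul0r subr0 ln1.
  by rewrite !ln1; lra.
rewrite factS ln_natM ?fact_gt0//; set m := n.+1 in IHn *.
have m0 : 0 < m%:R :> R by rewrite ltr0n.
have -> : m.+1%:R = m%:R * (1 + m%:R^-1) :> R by rewrite -natr1; field; lra.
have Vm0 : 0 < (m%:R : R)^-1 by rewrite invr_gt0.
have V1 : 0 < 1 + (m%:R : R)^-1 by lra.
rewrite lnM ?posrE//.
have := @le_ln1Dx R m%:R^-1; set t := ln (1 + _) => /(_ _) le_t.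
have {}le_t : t <= m%:R^-1 by apply: le_t; lra.
have : m%:R * t <= 1 by rewrite mulrC -ler_pdivlMr// mul1r.
by rewrite [m%:R * (1 + _)]mulrDr mulr1 divff ?gt_eqF//; lra.
Qed.

Lemma ceil_natP x : 0 <= x -> x <= `|Num.ceil x|%N%:R < x + 1.
Proof.
move=> x0; have c0 : 0 <= Num.ceil x by rewrite ceil_ge0; lra.
rewrite natr_absz ger0_norm//; have := ceil_itv x.
by rewrite intrD; lra.
Qed.

Lemma ceil_pow_ge n e : n%:R `^ e <= (ceil_pow n e)%:R.
Proof. by case/andP: (ceil_natP _ (powR_ge0 n%:R e)). Qed.

Lemma ceil_pow_lt n e : (ceil_pow n e)%:R < n%:R `^ e + 1.
Proof. by case/andP: (ceil_natP _ (powR_ge0 n%:R e)). Qed.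

Lemma ceil_pow_gt0 n e : (0 < n)%N -> (0 < ceil_pow n e)%N.
Proof.
move=> n0; rewrite -(ltr0n R); apply: lt_le_trans (ceil_pow_ge n e).
by apply: powR_gt0; rewrite ltr0n.
Qed.

(** From ['C(n + d, n) * n! <= (n + d)^n] and [n + d <= 2 n^(1 + e)]. The constant 2 collects
    [ln 2 <= 1] and the loss [n] in [ln_fact_ge]. *)
Lemma ln_bin_le n d e : (0 < n)%N -> 0 <= e -> (d%:R <= n%:R `^ (1 + e) :> R) ->
  ln 'C(n + d, n)%:R <= n%:R * (2 + e * ln n%:R) :> R.
Proof.
move=> n0 e0 de; have nR0 : 0 < n%:R :> R by rewrite ltr0n.
have C0 : (0 < 'C(n + d, n))%N by rewrite bin_gt0 leq_addr.
have CE : (0 < 'C(n + d, n) * n`!)%N by rewrite muln_gt0 C0 fact_gt0.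
have := ler_ln_nat _ _ CE; rewrite bin_ffact => /(_ _ (ffact_leq_expn _ _)).
rewrite -bin_ffact ln_natM ?fact_gt0// ln_natX ?addn_gt0 ?n0//.
have n_le : n%:R <= n%:R `^ (1 + e) :> R.
  by rewrite -{1}[n%:R]powRr1 ?ler0n// ler_powR ?ler1n//; lra.
have : ln (n + d)%:R <= ln 2 + (1 + e) * ln n%:R :> R.
  rewrite -ln_powR -lnM ?posrE ?powR_gt0// ler_ln ?posrE
    ?mulr_gt0 ?powR_gt0 ?ltr0n ?addn_gt0 ?n0//.
  by rewrite natrD; lra.
have := ln_fact_ge n; have := ln2_le1; nra.
Qed.

Lemma ln_E_le k n e : (0 < n)%N -> 1 <= e <= 2 -> 
  ln (E n k (ceil_pow n e))%:R <= n%:R * (1 + (2 - e) * ln n%:R) :> R.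
Proof.
move=> n0 /andP[e1 e2]; have nR0 : 0 < n%:R :> R by rewrite ltr0n.
have nR1 : 1 <= n%:R :> R by rewrite ler1n.
have nR_neq0 : n%:R != 0 :> R by rewrite gt_eqF.
pose b := ceil_pow n (e - 1).
have b0 : (0 < b)%N by apply: ceil_pow_gt0.
have nbd : (n * b.-1 < ceil_pow n e)%N.
  rewrite -(ltr_nat R); apply: lt_le_trans (ceil_pow_ge n e).
  have -> : n%:R `^ e = n%:R * n%:R `^ (e - 1) :> R.
    by rewrite -{2}[n%:R]powRr1 ?ler0n// -powRD ?subrKC ?nR_neq0 ?implybT.
  rewrite natrM ltr_pM2l//; have := ceil_pow_lt n (e - 1).
  by rewrite -/b -{1}(prednK b0) -natr1; lra.
have := E_le_block k _ _ b0 nbd.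
(* With the convention [ln 0 = 0], this case only needs a nonnegative bound. *)
have [->|E0] := posnP (E n k (ceil_pow n e)).
  move=> _; rewrite ln0 //; rewrite pmulr_rge0//.
  by rewrite addr_ge0 ?mulr_ge0 ?ln_ge0//; lra.
move=> /(ler_ln_nat _ _ E0)/le_trans; apply.
rewrite ln_natX// ler_pM2l//.
(* Absorbs the successor: there are at most [n^(2 - e) + 1 <= 2 n^(2 - e)] intervals. *)
have n1 : 1 <= n%:R `^ (2 - e) :> R.
  by rewrite -[leLHS](powRr0 n%:R) ler_powR//; lra.
have : ln (n %/ b).+1%:R <= ln 2 + (2 - e) * ln n%:R :> R.
  rewrite -ln_powR -lnM ?posrE ?powR_gt0// ler_ln ?posrE
    ?mulr_gt0 ?powR_gt0 ?ltr0n//.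
  rewrite -natr1; suff : (n %/ b)%:R <= n%:R `^ (2 - e) :> R by lra.
  rewrite -(@ler_pM2r _ b%:R) ?ltr0n// -natrM.
  apply: (@le_trans _ _ n%:R); first by rewrite ler_nat leq_trunc_div.
  apply: (@le_trans _ _ (n%:R `^ (2 - e) * n%:R `^ (e - 1))); last first.
    by rewrite ler_pM2l ?powR_gt0// ceil_pow_ge.
  rewrite -powRD ?nR_neq0 ?implybT//.
  by have -> : 2 - e + (e - 1) = 1 by [lra]; rewrite powRr1.
by have := ln2_le1; lra.
Qed.

Lemma ln_E_ge k n d L e : (0 < n)%N -> (0 < k)%N -> (0 < d)%N -> (0 < L)%N ->
  (L.*2 <= n)%N -> 0 <= e -> d.-1%:R <= n%:R `^ (1 + e) :> R ->
  (n - L.*2)%:R * ln L%:R - n%:R * (2 + e * ln n%:R) <= ln (E n k d)%:R :> R.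
Proof.
move=> n0 k0 d0 L0 Ln e0 de.
have := leq_trans (card_B_ge L k Ln k0) (gilbert_varshamov k d d0).
have LX0 : (0 < L ^ (n - L.*2))%N by rewrite expn_gt0 L0.
move=> le_LX; have := leq_trans LX0 le_LX; rewrite muln_gt0 => /andP[E0 C0].
have := ler_ln_nat _ _ LX0 le_LX; rewrite ln_natX// ln_natM//.
by have := ln_bin_le _ _ _ n0 e0 de; lra.
Qed.

End Logarithms.

(** * Normalized logarithms and their limits *)

Section Asymptotics.
Local Open Scope classical_set_scope.
Context {R : realType}.
Implicit Types (n k : nat) (e : R).

(* Both 1 / ln n = eps^2 and ln (ln n) / ln n <= 2 eps, so polynomials in [eps n]
   dominate all the error terms. *)
Definition eps n : R := (Num.sqrt (ln n%:R))^-1.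

Lemma near_ln_ge (A : R) : \forall n \near \oo, A <= ln n%:R :> R.
Proof.
near=> n; rewrite -[A]expRK ler_ln ?posrE ?expR_gt0//.
  near: n; exact: nbhs_infty_ger.
by rewrite ltr0n; near: n; exact: nbhs_infty_gt.
Unshelve. all: by end_near. Qed.

Lemma cvg_eps : eps n @[n --> \oo] --> 0.
Proof.
apply/gtr0_cvgV0.
  near=> n; rewrite sqrtr_gt0; apply: (@lt_le_trans _ _ 1) => //.
  by near: n; exact: near_ln_ge.
apply/cvgryPge => A; near=> n.
apply: (@le_trans _ _ `|A|); first exact: ler_norm.
rewrite -sqrtr_sqr ler_sqrt; first by near: n; exact: near_ln_ge.
apply: (@le_trans _ _ (A ^+ 2)); first exact: sqr_ge0.
by near: n; exact: near_ln_ge.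
Unshelve. all: by end_near. Qed.

(** Reduces the limit of each error term below to the value of a polynomial at 0. *)
Lemma cvg_poly_eps (p : {poly R}) (f : R -> R) :
  horner p =1 f -> f (eps n) @[n --> \oo] --> f 0.
Proof.
move=> /funext <-; apply: continuous_cvg cvg_eps; exact: continuous_horner.
Qed.

Lemma near_eps : \forall n \near \oo,
  [/\ (0 < n)%N, 0 < eps n <= 1 / 4, ln n%:R * eps n ^+ 2 = 1 & 1 <= n%:R * eps n].
Proof.
near=> n.
(* The threshold 16 gives [eps n <= 1 / 4]. *)
have l16 : 16 <= ln n%:R :> R by near: n; exact: near_ln_ge.
have n0 : (0 < n)%N by near: n; exact: nbhs_infty_gt.
have l0 : 0 < ln n%:R :> R by lra.
have s0 : 0 < Num.sqrt (ln n%:R) :> R by rewrite sqrtr_gt0.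
have s4 : 4 <= Num.sqrt (ln n%:R) :> R.
  have -> : 4 = Num.sqrt (4 ^+ 2) :> R by rewrite sqrtr_sqr ger0_norm.
  by rewrite ler_sqrt ?(ltW l0)//; lra.
split=> //; rewrite /eps.
- by rewrite invr_gt0 s0 /= div1r lef_pV2 ?posrE.
- by rewrite exprVn sqr_sqrtr ?divff ?gt_eqF// ltW.
- rewrite ler_pdivlMr// mul1r.
  have : ln n%:R < n%:R :> R by rewrite ln_sublinear ?ltr0n.
  have := sqr_sqrtr (ltW l0); nra.
Unshelve. all: by end_near. Qed.

Definition norm_ln_fact n : R := ln n`!%:R / (n%:R * ln n%:R).

Definition norm_ln_E e1 e2 n : R :=
  ln (E n (ceil_pow n e1) (ceil_pow n e2))%:R / (n%:R * ln n%:R).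

Lemma rateE e1 e2 n : n%:R * ln n%:R != 0 :> R ->
  rate e1 e2 n = norm_ln_E e1 e2 n / norm_ln_fact n.
Proof.
move=> nl; have ln2 : ln 2 != 0 :> R by rewrite gt_eqF// ln_gt0// ltr1n.
by rewrite /rate /log2 /norm_ln_E /norm_ln_fact -!mulf_div !divff ?mulr1 ?invr_neq0.
Qed.

Lemma cvg_norm_ln_fact : norm_ln_fact n @[n --> \oo] --> (1 : R).
Proof.
apply: (@squeeze_cvgr _ _ _ _ (fun n => 1 - eps n ^+ 2) (fun=> 1)).
- near=> n; have [n0 /andP[w0 _] lw _] : [/\ (0 < n)%N, 0 < eps n <= 1 / 4,
    ln n%:R * eps n ^+ 2 = 1 & 1 <= n%:R * eps n] by near: n; exact: near_eps.
  have nR0 : 0 < n%:R :> R by rewrite ltr0n.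
  have l0 : 0 < ln n%:R :> R by have := exprn_gt0 2 w0; nra.
  rewrite ler_pdivlMr ?ler_pdivrMr ?mulr_gt0// mul1r ln_fact_le// andbT.
  have -> : (1 - eps n ^+ 2) * (n%:R * ln n%:R) =
      n%:R * ln n%:R - n%:R * (ln n%:R * eps n ^+ 2) by ring.
  by rewrite lw mulr1 ln_fact_ge.
- have := @cvg_poly_eps (1 - 'X ^+ 2) (fun x => 1 - x ^+ 2).
  by rewrite expr0n subr0; apply=> x; rewrite !hornerE.
- exact: cvg_cst.
Unshelve. all: by end_near. Qed.

(** The factors bound [(n - 2L) / n] and [ln L / ln n] from below, where [2 * eps n] in the first
    pays for the ceiling in [L]. The subtracted terms are the logarithm of the ball size divided by
    [n * ln n]. *)
Lemma near_norm_ln_E_ge e1 e2 e : 0 <= e -> e2 <= 1 + e ->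
  \forall n \near \oo,
    (1 - 2 * eps n ^+ 2 - 2 * eps n) * (1 - 2 * eps n) - 2 * eps n ^+ 2 - e
      <= norm_ln_E e1 e2 n.
Proof.
move=> e_ge0 e2_le; near=> n.
have [n0 /andP[w0 w4] lw nw] : [/\ (0 < n)%N, 0 < eps n <= 1 / 4,
    ln n%:R * eps n ^+ 2 = 1 & 1 <= n%:R * eps n] by near: n; exact: near_eps.
have nR0 : 0 < n%:R :> R by rewrite ltr0n.
have w20 := exprn_gt0 2 w0; have l0 : 0 < ln n%:R :> R by nra.
have nw20 : 0 < n%:R * eps n ^+ 2 by rewrite mulr_gt0.
pose L := `|Num.ceil (n%:R * eps n ^+ 2)|%N.
have /andP[L_ge L_lt] := ceil_natP _ (ltW nw20); rewrite -/L in L_ge L_lt.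
have L0 : (0 < L)%N by rewrite -(ltr0n R); apply: lt_le_trans L_ge.
have Ln : (L.*2 <= n)%N.
  rewrite -(ler_nat R) -mul2n natrM.
  apply: (@le_trans _ _ (2 * (n%:R * eps n ^+ 2 + 1))).
    by rewrite ler_pM2l// ltW.
  by have : n%:R * eps n ^+ 2 <= n%:R * eps n * (1 / 4) :> R; nra.
have d_le : (ceil_pow n e2).-1%:R <= n%:R `^ (1 + e) :> R.
  apply: (@le_trans _ _ (n%:R `^ e2)); last by rewrite ler_powR ?ler1n.
  have := ceil_pow_lt n e2.
  by rewrite -{1}(prednK (ceil_pow_gt0 _ e2 n0)) -natr1; lra.
have := ln_E_ge _ _ _ L e n0 (ceil_pow_gt0 _ e1 n0) (ceil_pow_gt0 _ e2 n0)
  L0 Ln e_ge0 d_le.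
rewrite ler_pdivlMr ?mulr_gt0//; apply: le_trans.
(* [ln (n * eps^2) = ln n - 2 ln (1 / eps)], and [ln (1 / eps) < 1 / eps = eps * ln n]. *)
have lnL : ln n%:R * (1 - 2 * eps n) <= ln L%:R :> R.
  apply: (@le_trans _ _ (ln (n%:R * eps n ^+ 2))); last first.
    by rewrite ler_ln ?posrE ?ltr0n.
  rewrite lnM ?posrE// lnXn// mulr2n.
  have : ln (eps n)^-1 < (eps n)^-1 by apply: ln_sublinear; rewrite invr_gt0.
  rewrite lnV ?posrE//.
  have : ln n%:R * eps n = (eps n)^-1.
    by apply: (mulIf (lt0r_neq0 w0)); rewrite -mulrA -expr2 lw mulVf ?gt_eqF.
  by lra.
have n2L : n%:R * (1 - 2 * eps n ^+ 2 - 2 * eps n) <= (n - L.*2)%:R :> R.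
  rewrite natrB// -mul2n natrM; nra.
rewrite -subr_ge0.
set l := ln n%:R in lnL lw l0 *; set M := (n - L.*2)%:R in n2L *.
set W := eps n in w0 w4 lw nw w20 nw20 lnL n2L *.
have W2 : 0 <= 1 - 2 * W ^+ 2 - 2 * W by nra.
have : (n%:R * (1 - 2 * W ^+ 2 - 2 * W)) * (l * (1 - 2 * W)) <= M * ln L%:R.
  apply: ler_pM => //; first by rewrite mulr_ge0// ltW.
  by rewrite mulr_ge0//; lra.
have -> : M * ln L%:R - n%:R * (2 + e * l)
    - ((1 - 2 * W ^+ 2 - 2 * W) * (1 - 2 * W) - 2 * W ^+ 2 - e) * (n%:R * l)
  = M * ln L%:R - (n%:R * (1 - 2 * W ^+ 2 - 2 * W)) * (l * (1 - 2 * W))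
    + 2 * n%:R * (l * W ^+ 2 - 1) by ring.
by rewrite lw; lra.
Unshelve. all: by end_near. Qed.

Lemma near_norm_ln_E_le e1 e2 : e2 <= 2 ->
  \forall n \near \oo,
    norm_ln_E e1 e2 n <= (if e2 <= 1 then 1 else 2 - e2) + eps n ^+ 2.
Proof.
move=> e2_2; near=> n.
have [n0 /andP[w0 w4] lw nw] : [/\ (0 < n)%N, 0 < eps n <= 1 / 4,
    ln n%:R * eps n ^+ 2 = 1 & 1 <= n%:R * eps n] by near: n; exact: near_eps.
have nR0 : 0 < n%:R :> R by rewrite ltr0n.
have w20 := exprn_gt0 2 w0; have l0 : 0 < ln n%:R :> R by nra.
rewrite ler_pdivrMr ?mulr_gt0//; case: ifPn => [_|].
  apply: (@le_trans _ _ (n%:R * ln n%:R)).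
    apply: le_trans (ln_fact_le n n0).
    have [->|E0] := posnP (E n (ceil_pow n e1) (ceil_pow n e2)).
      by rewrite ln0// ln_ge0// ler1n fact_gt0.
    by rewrite ler_ln_nat ?E_le_fact.
  by have : 0 <= n%:R * ln n%:R :> R; nra.
rewrite -ltNge => e2_1; apply: le_trans (ln_E_le _ _ _ n0 _) _.
  by rewrite ltW.
have -> : (2 - e2 + eps n ^+ 2) * (n%:R * ln n%:R) =
    n%:R * (ln n%:R * eps n ^+ 2 + (2 - e2) * ln n%:R) by ring.
by rewrite lw.
Unshelve. all: by end_near. Qed.

Lemma cvg_norm_ln_E e1 e2 : e2 <= 2 ->
  norm_ln_E e1 e2 n @[n --> \oo] --> (if e2 <= 1 then 1 else 2 - e2 : R).
Proof.
move=> e2_2; set c := (if _ then _ else _).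
(* The exponent [1 - c] is 0 when [e2 <= 1] and [e2 - 1] otherwise, which treats both cases at
   once. *)
have lower := near_norm_ln_E_ge e1 e2 (1 - c).
have upper := near_norm_ln_E_le e1 e2 e2_2.
apply: (@squeeze_cvgr _ _ _ _
  (fun n => (1 - 2 * eps n ^+ 2 - 2 * eps n) * (1 - 2 * eps n)
    - 2 * eps n ^+ 2 - (1 - c))
  (fun n => c + eps n ^+ 2)).
- have {}lower := lower _ _; near=> n; apply/andP; split; near: n => //.
  by apply: lower; rewrite /c; case: ifP; lra.
- have := @cvg_poly_eps 
    ((1 - 2%:P * 'X ^+ 2 - 2%:P * 'X) * (1 - 2%:P * 'X) - 2%:P * 'X ^+ 2 - (1 - c)%:P)
    (fun x => (1 - 2 * x ^+ 2 - 2 * x) * (1 - 2 * x) - 2 * x ^+ 2 - (1 - c)).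
  by rewrite expr0n !mulr0 !subr0 mulr1 subKr; apply=> x; rewrite !hornerE.
- have := @cvg_poly_eps (c%:P + 'X ^+ 2) (fun x => c + x ^+ 2).
  by rewrite expr0n addr0; apply=> x; rewrite !hornerE.
Unshelve. all: by end_near. Qed.

End Asymptotics.

Theorem theorem7 (R : realType) (e1 e2 : R)
    (he1 : 0 <= e1 <= 1) (he2 : 0 <= e2 <= 2) :
  cvgn (rate e1 e2) /\
  capacity e1 e2 = (if e2 <= 1 then 1 else 2 - e2).
Proof.
have /andP[_ e2_2] := he2.
suff cvg_rate :
    (rate e1 e2 n @[n --> \oo] --> (if e2 <= 1 then 1 else 2 - e2 : R))%classic.
  by split; [apply: cvgP cvg_rate | apply: cvg_lim cvg_rate].
(* The rate is eventually the quotient of the two normalized logarithms, and the denominator tends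
   to 1. *)
rewrite -[X in (_ --> X)%classic]divr1.
apply: cvg_trans (cvgM (cvg_norm_ln_E e1 e2 e2_2)
  (cvgV (oner_neq0 R) (@cvg_norm_ln_fact R))).
apply: near_eq_cvg; near=> n.
rewrite /= rateE// mulf_neq0 ?gt_eqF// ?ltr0n;
  first by near: n; exact: nbhs_infty_gt.
by apply: (@lt_le_trans _ _ 1) => //; near: n; exact: near_ln_ge.
Unshelve. all: by end_near. Qed.
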